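(* The following hold for the functors $\mathbf{\Omega}:\mathbf{Top}\to\mathbf{Loc}$, $\mathbf{Pt}:\mathbf{Loc}\to\mathbf{Top}$, $\mathbf{\Lambda}:\mathbf{Top}\to\mathbf{PTop}$, $\mathbf{Pt}^+:\mathbf{PTop}\to\mathbf{Top}$, $\mathbf{U}:\mathbf{PTop}\to\mathbf{Loc}$ and $\mathbf{\Delta}:\mathbf{Loc}\to\mathbf{PTop}$: 1. $\mathbf{Pt}=\mathbf{Pt}^+\circ\mathbf{\Delta}$; 2. $\mathbf{\Omega}=\mathbf{U}\circ\mathbf{\Lambda}$; 3. $\mathbf{\Lambda}\dashv\mathbf{Pt}^+$, i.e. $\mathbf{\Lambda}$ is left adjoint to $\mathbf{Pt}^+$. As a consequence, the adjunction $\mathbf{\Omega}\dashv\mathbf{Pt}$ between $\mathbf{Top}$ and $\mathbf{Loc}$ factors through the adjunction $\mathbf{U}\dashv\mathbf{\Delta}$ between $\mathbf{PTop}$ and $\mathbf{Loc}$, as the composite of $\mathbf{\Lambda}\dashv\mathbf{Pt}^+$ followed by $\mathbf{U}\dashv\mathbf{\Delta}$.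
   Context: The foundational framework is intuitionistic and impredicative (e.g. the internal language of a topos); excluded middle is not assumed. A suplattice is a poset with all joins; $\mathbf{SL}$ is the category of suplattices and join-preserving maps (suplattice homomorphisms). $\Omega=\mathcal{P}(1)$ is the frame of truth values. $\mathbf{SL}(L,\Omega)$ is a suplattice under pointwise joins; a sub-suplattice of it is a subset closed under arbitrary joins. $\mathbf{Frm}$ is the category of frames and maps preserving arbitrary joins and finite meets; $\mathbf{Loc}=\mathbf{Frm}^{op}$. $\mathbf{Top}$ is the category of topological spaces and continuous maps. $\mathbf{PTop}$ (positive topologies) is the category whose objects are pairs $(L,\Phi)$ with $L$ a frame and $\Phi$ a sub-suplattice of $\mathbf{SL}(L,\Omega)$, and whose arrows $(L,\Phi)\to(M,\Psi)$ are frame homomorphisms $f:M\to L$ such that $\Phi\circ f\subseteq\Psi$, where $\Phi\circ f=\{\varphi\circ f\mid\varphi\in\Phi\}$. The functors are as follows. - $\mathbf{\Omega}$ sends a space $(X,\tau)$ to its frame of opens $\tau$, and a continuous $f:(X,\tau_X)\to(Y,\tau_Y)$ to the locale morphism given by the frame homomorphism $f^{-1}:\tau_Y\to\tau_X$. - $\mathbf{Pt}$ sends a locale $L$ to the space of its points, i.e. frame homomorphisms $p:L\to\Omega$, with opens the sets $\{p\mid p(y)=1\}$ for $y\in L$; a locale morphism $L\to M$ given by a frame homomorphism $f:M\to L$ is sent to $p\mapsto p\circ f$. One has $\mathbf{\Omega}\dashv\mathbf{Pt}$. - $\mathbf{U}$ is the forgetful functor $(L,\Phi)\mapsto L$, and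 $\mathbf{\Delta}$ sends a locale $L$ to $(L,\mathbf{SL}(L,\Omega))$; both act as the identity on the underlying morphisms. One has $\mathbf{U}\dashv\mathbf{\Delta}$. - $\mathbf{Pt}^+(L,\Phi)$ is the set $\mathbf{PTop}(\mathbf{\Delta}(\Omega),(L,\Phi))$ of global points of $(L,\Phi)$; these are exactly the frame homomorphisms $p:L\to\Omega$ with $p\in\Phi$, and $\mathbf{Pt}^+(L,\Phi)$ is topologized as a subspace of $\mathbf{Pt}(L)$. An arrow $(L,\Phi)\to(M,\Psi)$ with underlying frame homomorphism $f:M\to L$ is sent to the continuous map $p\mapsto p\circ f$. - For subsets $U,V$ of a set, $U\between V$ means that $U\cap V$ is inhabited. A subset $C$ of a space $(X,\tau)$ is closed if for all $x\in X$: whenever $C\between I$ for every $I\in\tau$ with $x\in I$, then $x\in C$. For closed $C$, $\varphi_C\in\mathbf{SL}(\tau,\Omega)$ is the map sending $I\in\tau$ to the truth value of $C\between I$. The set $\{\varphi_C\mid C\text{ closed}\}$ is a sub-suplattice of $\mathbf{SL}(\tau,\Omega)$. Then $\mathbf{\Lambda}(X,\tau)=(\tau,\{\varphi_C\mid C\text{ closed}\})$, and for continuous $f:(X,\tau_X)\to(Y,\tau_Y)$, $\mathbf{\Lambda}(f)$ is the arrow given by the frame homomorphism $f^{-1}:\tau_Y\to\tau_X$. *)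

(* Defs.v *)
(* Propositional and functional extensionality hold in the internal language of
   a topos; excluded middle and choice are not used.  Truth values are the
   elements of the impredicative sort [Prop], subsets of [A] are predicates
   [A -> Prop], and equality of elements, arrows, objects and functors is
   Leibniz equality throughout. *)
From Stdlib Require Import FunctionalExtensionality PropExtensionality
  ProofIrrelevance.

Set Implicit Arguments.
Unset Strict Implicit.
Unset Printing Implicit Defensive.

Definition image {A B : Type} (f : A -> B) (S : A -> Prop) : B -> Prop :=
  fun b => exists a, S a /\ f a = b.

Definition meets {A : Type} (U V : A -> Prop) : Prop := exists x, U x /\ V x.

Lemma pred_ext {A : Type} (U V : A -> Prop) : (forall x, U x <-> V x) -> U = V.
Proof.
intros H; apply functional_extensionality; intros x.
now apply propositional_extensionality.
Qed.

Lemma sig_ext {A : Type} {P : A -> Prop} (u v : sig P) :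
  proj1_sig u = proj1_sig v -> u = v.
Proof.
destruct u as [a p], v as [b q]; simpl; intros e; destruct e.
now rewrite (proof_irrelevance _ p q).
Qed.

(* ** Categories, functors, adjunctions *)

Record Category := {
  Ob :> Type;
  Hom : Ob -> Ob -> Type;
  ident : forall X, Hom X X;
  comp : forall X Y Z, Hom Y Z -> Hom X Y -> Hom X Z;
  comp_ident_l : forall X Y (f : Hom X Y), comp (ident Y) f = f;
  comp_ident_r : forall X Y (f : Hom X Y), comp f (ident X) = f;
  comp_assoc : forall W X Y Z (h : Hom Y Z) (g : Hom X Y) (f : Hom W X),
    comp h (comp g f) = comp (comp h g) f }.
Arguments Hom {_} _ _.
Arguments ident {_} _.
Arguments comp {_ _ _ _} _ _.

Definition op (C : Category) : Category := {|
  Ob := C;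
  Hom X Y := @Hom C Y X;
  ident X := @ident C X;
  comp X Y Z g f := @comp C Z Y X f g;
  comp_ident_l X Y f := comp_ident_r f;
  comp_ident_r X Y f := comp_ident_l f;
  comp_assoc W X Y Z h g f := eq_sym (comp_assoc f g h) |}.

Record Functor (C D : Category) := {
  fobj :> C -> D;
  fmap : forall X Y : C, Hom X Y -> Hom (fobj X) (fobj Y);
  fmap_ident : forall X, fmap (ident X) = ident (fobj X);
  fmap_comp : forall X Y Z (g : Hom Y Z) (f : Hom X Y),
    fmap (comp g f) = comp (fmap g) (fmap f) }.
Arguments fmap {_ _} _ {_ _} _.

Definition compF {C D E : Category} (G : Functor D E) (F : Functor C D) :
  Functor C E.
Proof.
refine {| fobj X := G (F X); fmap X Y f := fmap G (fmap F f) |}.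
- abstract (intros X; now rewrite !fmap_ident).
- abstract (intros X Y Z g f; now rewrite !fmap_comp).
Defined.

(* [Adjunction F G]: [F] is left adjoint to [G]. *)
Record Adjunction {C D : Category} (F : Functor C D) (G : Functor D C) := {
  adj_unit : forall X : C, Hom X (G (F X));
  adj_counit : forall Y : D, Hom (F (G Y)) Y;
  adj_unit_natural : forall (X X' : C) (f : Hom X X'),
    comp (adj_unit X') f = comp (fmap G (fmap F f)) (adj_unit X);
  adj_counit_natural : forall (Y Y' : D) (g : Hom Y Y'),
    comp (adj_counit Y') (fmap F (fmap G g)) = comp g (adj_counit Y);
  triangle_l : forall X : C, comp (adj_counit (F X)) (fmap F (adj_unit X)) = ident (F X);
  triangle_r : forall Y : D, comp (fmap G (adj_counit Y)) (adj_unit (G Y)) = ident (G Y) }.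
Arguments adj_unit {_ _ _ _} _ _.
Arguments adj_counit {_ _ _ _} _ _.

Definition compAdj {C D E : Category}
    {F : Functor C D} {G : Functor D C} {F' : Functor D E} {G' : Functor E D}
    (A : Adjunction F G) (A' : Adjunction F' G') :
  Adjunction (compF F' F) (compF G G').
Proof.
refine {| adj_unit X := comp (fmap G (adj_unit A' (F X))) (adj_unit A X) :
            Hom X (compF G G' (compF F' F X));
          adj_counit Y := comp (adj_counit A' Y) (fmap F' (adj_counit A (G' Y))) :
            Hom (compF F' F (compF G G' Y)) Y |}; simpl.
- abstract (intros X X' f;
    rewrite <- comp_assoc, (adj_unit_natural A), !comp_assoc, <- !fmap_comp;
    now rewrite (adj_unit_natural A')).
- abstract (intros Y Y' g;
    rewrite <- comp_assoc, <- fmap_comp, (adj_counit_natural A), fmap_comp,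
      !comp_assoc;
    now rewrite (adj_counit_natural A')).
- abstract (intros X;
    rewrite <- comp_assoc, <- fmap_comp, (fmap_comp F), (comp_assoc (adj_counit A _)),
      (adj_counit_natural A), <- comp_assoc, (triangle_l A), comp_ident_r;
    apply (triangle_l A')).
- abstract (intros Y;
    rewrite comp_assoc, <- fmap_comp, (fmap_comp G'), <- (comp_assoc _ _ (adj_unit A' _)),
      <- (adj_unit_natural A'), comp_assoc, (triangle_r A'), comp_ident_l;
    apply (triangle_r A)).
Defined.

Definition castAdj {C D : Category} {F F' : Functor C D} {G G' : Functor D C}
    (eF : F = F') (eG : G = G') (A : Adjunction F G) : Adjunction F' G' :=
  match eF in _ = F1, eG in _ = G1 return Adjunction F1 G1 with
  | eq_refl, eq_refl => A
  end.

(* ** Suplattices and frames *)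

Record Suplattice := {
  car :> Type;
  le : car -> car -> Prop;
  sup : (car -> Prop) -> car;
  le_refl : forall a, le a a;
  le_trans : forall a b c, le a b -> le b c -> le a c;
  le_antisym : forall a b, le a b -> le b a -> a = b;
  sup_lub : forall S b, le (sup S) b <-> (forall a, S a -> le a b) }.
Arguments le {_} _ _.
Arguments sup {_} _.

Record Frame := {
  frame_sl :> Suplattice;
  top : frame_sl;
  meet : frame_sl -> frame_sl -> frame_sl;
  le_top : forall a, le a top;
  meet_glb : forall a b c, le c (meet a b) <-> le c a /\ le c b;
  meet_sup : forall a S, meet a (sup S) = sup (image (meet a) S) }.
Arguments top {_}.
Arguments meet {_} _ _.

Definition is_sl_hom {L M : Suplattice} (f : L -> M) : Prop :=
  forall S, f (sup S) = sup (image f S).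

Definition is_frame_hom {L M : Frame} (f : L -> M) : Prop :=
  is_sl_hom f /\ f top = top /\ forall a b, f (meet a b) = meet (f a) (f b).

Definition pointwise_sup {L M : Suplattice} (S : (L -> M) -> Prop) : L -> M :=
  fun a => sup (image (fun phi => phi a) S).

Lemma is_frame_hom_id (L : Frame) : is_frame_hom (fun a : L => a).
Proof.
split; [|now split]; intros S; f_equal; apply pred_ext; intros a; split.
- intros Sa; now exists a.
- intros [b [Sb e]]; now subst.
Qed.

Lemma is_sl_hom_comp {L M N : Suplattice} (g : M -> N) (f : L -> M) :
  is_sl_hom g -> is_sl_hom f -> is_sl_hom (fun a => g (f a)).
Proof.
intros Hg Hf S; rewrite Hf, Hg; f_equal; apply pred_ext; intros c; split.
- intros [b [[a [Sa <-]] <-]]; now exists a.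
- intros [a [Sa <-]]; exists (f a); split; [now exists a | reflexivity].
Qed.

Lemma is_frame_hom_comp {L M N : Frame} (g : M -> N) (f : L -> M) :
  is_frame_hom g -> is_frame_hom f -> is_frame_hom (fun a => g (f a)).
Proof.
intros [Hg [Tg Mg]] [Hf [Tf Mf]]; split; [|split].
- now apply is_sl_hom_comp.
- now rewrite Tf.
- intros a b; now rewrite Mf, Mg.
Qed.

Definition Omega_sl : Suplattice.
Proof.
refine {| car := Prop; le P Q := P -> Q; sup S := exists P, S P /\ P |}.
- abstract auto.
- abstract auto.
- abstract (intros P Q PQ QP; now apply propositional_extensionality).
- abstract (intros S Q; split;
    [intros H P SP p; apply H; now exists P
    |intros H [P [SP p]]; now apply (H P)]).
Defined.

(* The frame of truth values; its top element 1 is [True]. *)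
Definition Omega : Frame.
Proof.
refine {| frame_sl := Omega_sl; top := True; meet P Q := P /\ Q |}.
- abstract (intros P; simpl; auto).
- abstract (intros P Q R; simpl; tauto).
- abstract (intros P S; apply propositional_extensionality; split;
    [intros [p [Q [SQ q]]]; exists (P /\ Q); split; [now exists Q | now split]
    |intros [R [[Q [SQ <-]] [p q]]]; split; [assumption | now exists Q]]).
Defined.

Definition Frm : Category.
Proof.
refine {| Ob := Frame;
          Hom L M := {f : L -> M | is_frame_hom f};
          ident L := exist _ (fun a => a) (is_frame_hom_id L);
          comp L M N g f := exist _ (fun a => proj1_sig g (proj1_sig f a))
            (is_frame_hom_comp (proj2_sig g) (proj2_sig f)) |}.
- abstract (intros; now apply sig_ext).
- abstract (intros; now apply sig_ext).
- abstract (intros; now apply sig_ext).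
Defined.

Definition Loc : Category := op Frm.

(* ** Topological spaces *)

Record Space := {
  pts :> Type;
  open : (pts -> Prop) -> Prop;
  open_union : forall S : (pts -> Prop) -> Prop,
    (forall U, S U -> open U) -> open (fun x => exists U, S U /\ U x);
  open_full : open (fun _ => True);
  open_inter : forall U V, open U -> open V -> open (fun x => U x /\ V x) }.
Arguments open {_} _.

Definition continuous {X Y : Space} (f : X -> Y) : Prop :=
  forall V, open V -> open (fun x => V (f x)).

Lemma continuous_id (X : Space) : continuous (fun x : X => x).
Proof. intros V OV; exact OV. Qed.

Lemma continuous_comp {X Y Z : Space} (g : Y -> Z) (f : X -> Y) :
  continuous g -> continuous f -> continuous (fun x => g (f x)).
Proof. intros Hg Hf V OV; exact (Hf _ (Hg V OV)). Qed.

Definition Top : Category.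
Proof.
refine {| Ob := Space;
          Hom X Y := {f : X -> Y | continuous f};
          ident X := exist _ (fun x => x) (@continuous_id X);
          comp X Y Z g f := exist _ (fun x => proj1_sig g (proj1_sig f x))
            (continuous_comp (proj2_sig g) (proj2_sig f)) |}.
- abstract (intros; now apply sig_ext).
- abstract (intros; now apply sig_ext).
- abstract (intros; now apply sig_ext).
Defined.

(* The topology induced on [Y] along [i]; when [i] is injective this is the
   subspace topology. *)
Definition induced {X : Space} {Y : Type} (i : Y -> X) : Space.
Proof.
refine {| pts := Y;
          open V := exists U : X -> Prop, open U /\ V = fun y => U (i y) |}.
- abstract (intros S HS;
    exists (fun x => exists U, (open U /\ S (fun y => U (i y))) /\ U x); split;
    [apply (open_union (S := fun U => open U /\ S (fun y => U (i y))));
      now intros U [OU _]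
    |apply pred_ext; intros y; split;
      [intros [V [SV Vy]]; destruct (HS V SV) as [U [OU e]]; subst V;
        now exists U
      |intros [U [[OU SU] Uy]]; now exists (fun z => U (i z))]]).
- abstract (exists (fun _ => True); split; [apply open_full | reflexivity]).
- abstract (intros V V' [U [OU ->]] [U' [OU' ->]];
    exists (fun x => U x /\ U' x); split; [now apply open_inter | reflexivity]).
Defined.

Lemma open_union_image {X : Space} (S : {U : X -> Prop | open U} -> Prop) :
  open (fun x => exists U, image (@proj1_sig _ _) S U /\ U x).
Proof. apply open_union; intros U [[U' OU'] [_ <-]]; exact OU'. Qed.

Definition opens_sl (X : Space) : Suplattice.
Proof.
refine {| car := {U : X -> Prop | open U};
          le U V := forall x, proj1_sig U x -> proj1_sig V x;
          sup S := exist _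
            (fun x => exists U, image (@proj1_sig _ _) S U /\ U x)
            (open_union_image S) |}.
- abstract auto.
- abstract auto.
- abstract (intros U V UV VU; apply sig_ext, pred_ext; intros x;
    split; [apply UV | apply VU]).
- abstract (intros S V; split;
    [intros H U SU x Ux; apply H; exists (proj1_sig U); split;
      [now exists U | assumption]
    |intros H x [U [[U' [SU' <-]] Ux]]; now apply (H U')]).
Defined.

Definition opens (X : Space) : Frame.
Proof.
refine {| frame_sl := opens_sl X;
          top := exist _ (fun _ => True) (open_full X);
          meet U V := exist _ (fun x => proj1_sig U x /\ proj1_sig V x)
            (open_inter (proj2_sig U) (proj2_sig V)) |}.
- abstract (intros U x _; exact I).
- abstract (intros U V W; split;
    [intros H; split; intros x Wx; now apply (H x)
    |intros [H1 H2] x Wx; split; [now apply H1 | now apply H2]]).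
- abstract (intros U S; apply sig_ext, pred_ext; intros x; split;
    [intros [Ux [V [[V' [SV' <-]] Vx]]];
      exists (fun x => proj1_sig U x /\ proj1_sig V' x); split; [|now split];
      exists (exist _ (fun x => proj1_sig U x /\ proj1_sig V' x)
        (open_inter (proj2_sig U) (proj2_sig V'))); split; [|reflexivity];
      now exists V'
    |intros [W [[W' [[V [SV <-]] <-]] [Ux Vx]]]; split; [assumption|];
      exists (proj1_sig V); split; [now exists V | assumption]]).
Defined.

Definition preimage {X Y : Space} (f : {f : X -> Y | continuous f}) :
  opens Y -> opens X :=
  fun V => exist _ (fun x => proj1_sig V (proj1_sig f x))
             (proj2_sig f _ (proj2_sig V)).

Lemma preimage_frame_hom {X Y : Space} (f : {f : X -> Y | continuous f}) :
  is_frame_hom (preimage f).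
Proof.
split; [|split].
- intros S; apply sig_ext, pred_ext; intros x; split.
  + intros [U [[V [SV <-]] Vx]].
    exists (fun x => proj1_sig V (proj1_sig f x)); split; [|assumption].
    exists (preimage f V); split; [now exists V | reflexivity].
  + intros [U [[U' [[V [SV <-]] <-]] Vx]].
    exists (proj1_sig V); split; [now exists V | assumption].
- now apply sig_ext.
- intros U V; now apply sig_ext.
Qed.

Definition OmegaF : Functor Top Loc.
Proof.
refine {| fobj := opens : Top -> Loc;
          fmap X Y f := exist _ (preimage f) (preimage_frame_hom f) :
            @Hom Loc (opens X) (opens Y) |}.
- abstract (intros X; apply sig_ext, functional_extensionality; intros U;
    now apply sig_ext).
- abstract (intros X Y Z g f; apply sig_ext, functional_extensionality;
    intros U; now apply sig_ext).
Defined.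

(* ** Points of a locale *)

(* Truth values are propositions, so [p y] says p(y) = 1. *)
Definition pt_space (L : Frame) : Space.
Proof.
refine {| pts := @Hom Frm L Omega;
          open V := exists y : L, V = fun p => proj1_sig p y |}.
- abstract (intros S HS;
    exists (sup (fun y => S (fun p => proj1_sig p y)));
    apply pred_ext; intros [p [Hp [Tp Mp]]]; simpl; rewrite Hp; split;
    [intros [V [SV Vp]]; destruct (HS V SV) as [y ->];
      exists (p y); split; [now exists y | exact Vp]
    |intros [P [[y [Sy <-]] py]]; now exists (fun p => proj1_sig p y)]).
- abstract (exists top; apply pred_ext; intros [p [Hp [Tp Mp]]]; simpl;
    now rewrite Tp).
- abstract (intros V V' [y ->] [y' ->]; exists (meet y y');
    apply pred_ext; intros [p [Hp [Tp Mp]]]; simpl; now rewrite Mp).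
Defined.

Lemma pt_map_continuous {L M : Frame} (f : @Hom Loc L M) :
  @continuous (pt_space L) (pt_space M) (fun p => @comp Frm _ _ _ p f).
Proof. intros V [y ->]; now exists (proj1_sig f y). Qed.

Definition Pt : Functor Loc Top.
Proof.
refine {| fobj := pt_space : Loc -> Top;
          fmap L M f := exist _ (fun p => @comp Frm _ _ _ p f)
            (pt_map_continuous f) : @Hom Top (pt_space L) (pt_space M) |}.
- abstract (intros L; apply sig_ext, functional_extensionality; intros p;
    now apply sig_ext).
- abstract (intros L M N g f; apply sig_ext, functional_extensionality;
    intros p; now apply sig_ext).
Defined.

Lemma mem_frame_hom {X : Space} (x : X) :
  @is_frame_hom (opens X) Omega (fun U => proj1_sig U x).
Proof.
split; [|now split]; intros S; apply propositional_extensionality; split.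
- intros [U [[U' [SU' <-]] Ux]].
  exists (proj1_sig U' x); split; [now exists U' | assumption].
- intros [P [[U [SU <-]] Ux]].
  exists (proj1_sig U); split; [now exists U | assumption].
Qed.

Definition pt_unit (X : Space) : @Hom Top X (pt_space (opens X)).
Proof.
refine (exist _ (fun x => exist _ _ (mem_frame_hom x)) _).
abstract (intros V [U ->]; exact (proj2_sig U)).
Defined.

Definition pt_counit (L : Frame) : @Hom Loc (opens (pt_space L)) L.
Proof.
refine (exist _ (fun y : L => exist _ (fun p => proj1_sig p y)
          (ex_intro _ y eq_refl) : opens (pt_space L)) _).
abstract (split; [|split];
  [intros S; apply sig_ext, pred_ext; intros [p [Hp [Tp Mp]]]; simpl;
    rewrite Hp; split;
    [intros [P [[y [Sy <-]] py]];
      exists (fun q : @Hom Frm L Omega => proj1_sig q y); split; [|exact py];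
      eexists; split; [now exists y | reflexivity]
    |intros [V [[V' [[y [Sy <-]] <-]] py]]; exists (p y); split;
      [now exists y | exact py]]
  |apply sig_ext, pred_ext; intros [p [Hp [Tp Mp]]]; simpl; now rewrite Tp
  |intros a b; apply sig_ext, pred_ext; intros [p [Hp [Tp Mp]]]; simpl;
    now rewrite Mp]).
Defined.

(* The unit sends [x] to the point [U |-> (x in U)]; the counit is the frame
   homomorphism [y |-> {p | p y}]. *)
Definition OmegaF_Pt : Adjunction OmegaF Pt.
Proof.
refine {| adj_unit := pt_unit : forall X : Top, Hom X (Pt (OmegaF X));
          adj_counit := pt_counit : forall L : Loc, Hom (OmegaF (Pt L)) L |}.
- abstract (intros X X' f; apply sig_ext, functional_extensionality; intros x;
    now apply sig_ext).
- abstract (intros L L' g; apply sig_ext, functional_extensionality; intros y;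
    now apply sig_ext).
- abstract (intros X; apply sig_ext, functional_extensionality; intros U;
    now apply sig_ext).
- abstract (intros L; apply sig_ext, functional_extensionality; intros p;
    now apply sig_ext).
Defined.

(* ** Positive topologies *)

(* [pos] is a sub-suplattice of SL(base, Omega), given as a set of functions
   all of which preserve joins. *)
Record PosTop := {
  base : Frame;
  pos : (base -> Omega) -> Prop;
  pos_sl_hom : forall phi, pos phi -> is_sl_hom phi;
  pos_sup : forall S : (base -> Omega) -> Prop,
    (forall phi, S phi -> pos phi) -> pos (pointwise_sup S) }.
Arguments pos : clear implicits.

(* [is_PTop_hom A B f]: [f] underlies an arrow [A -> B]; note that [f] goes
   from the frame of [B] to that of [A]. *)
Definition is_PTop_hom (A B : PosTop) (f : base B -> base A) : Prop :=
  is_frame_hom f /\ forall phi, pos A phi -> pos B (fun y => phi (f y)).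

Lemma is_PTop_hom_id (A : PosTop) : @is_PTop_hom A A (fun a => a).
Proof. split; [apply is_frame_hom_id|]; intros phi H; exact H. Qed.

Lemma is_PTop_hom_comp (A B C : PosTop)
    (g : base C -> base B) (f : base B -> base A) :
  is_PTop_hom g -> is_PTop_hom f -> @is_PTop_hom A C (fun z => f (g z)).
Proof.
intros [Hg Pg] [Hf Pf]; split; [now apply is_frame_hom_comp|].
intros phi Hphi; apply (Pg (fun y => phi (f y))), Pf, Hphi.
Qed.

Definition PTop : Category.
Proof.
refine {| Ob := PosTop;
          Hom A B := {f : base B -> base A | is_PTop_hom f};
          ident A := exist _ (fun a => a) (is_PTop_hom_id A);
          comp A B C g f := exist _ (fun z => proj1_sig f (proj1_sig g z))
            (is_PTop_hom_comp (proj2_sig g) (proj2_sig f)) |}.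
- abstract (intros; now apply sig_ext).
- abstract (intros; now apply sig_ext).
- abstract (intros; now apply sig_ext).
Defined.

Definition U : Functor PTop Loc.
Proof.
refine {| fobj := base : PTop -> Loc;
          fmap A B f := exist _ (proj1_sig f) (proj1 (proj2_sig f)) :
            @Hom Loc (base A) (base B) |}.
- abstract (intros; now apply sig_ext).
- abstract (intros; now apply sig_ext).
Defined.

Lemma pointwise_sup_sl_hom {L : Suplattice} (S : (L -> Omega) -> Prop) :
  (forall phi, S phi -> is_sl_hom phi) -> is_sl_hom (pointwise_sup S).
Proof.
intros HS T; apply propositional_extensionality; split.
- intros [P [[phi [Sphi <-]] H]]; rewrite (HS phi Sphi) in H.
  destruct H as [Q [[a [Ta <-]] Hq]].
  exists (pointwise_sup S a); split; [now exists a|].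
  exists (phi a); split; [now exists phi | exact Hq].
- intros [P [[a [Ta <-]] [Q [[phi [Sphi <-]] Hq]]]].
  exists (phi (sup T)); split; [now exists phi|].
  rewrite (HS phi Sphi); exists (phi a); split; [now exists a | exact Hq].
Qed.

Definition full_postop (L : Frame) : PosTop := {|
  base := L;
  pos := is_sl_hom;
  pos_sl_hom phi H := H;
  pos_sup S HS := pointwise_sup_sl_hom HS |}.

Lemma full_postop_hom {L M : Frame} (f : @Hom Loc L M) :
  @is_PTop_hom (full_postop L) (full_postop M) (proj1_sig f).
Proof.
split; [exact (proj2_sig f)|]; intros phi Hphi.
exact (is_sl_hom_comp Hphi (proj1 (proj2_sig f))).
Qed.

Definition Delta : Functor Loc PTop.
Proof.
refine {| fobj := full_postop : Loc -> PTop;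
          fmap L M f := exist _ (proj1_sig f) (full_postop_hom f) :
            @Hom PTop (full_postop L) (full_postop M) |}.
- abstract (intros; now apply sig_ext).
- abstract (intros; now apply sig_ext).
Defined.

(* Unit and counit are both given by identity frame homomorphisms. *)
Definition U_Delta : Adjunction U Delta.
Proof.
refine {| adj_unit := (fun A => exist _ (fun a => a)
            (conj (is_frame_hom_id (base A)) (@pos_sl_hom A))) :
            forall A : PTop, Hom A (Delta (U A));
          adj_counit := (fun L => @ident Frm L) :
            forall L : Loc, Hom (U (Delta L)) L |}.
- abstract (intros; now apply sig_ext).
- abstract (intros; now apply sig_ext).
- abstract (intros; now apply sig_ext).
- abstract (intros; now apply sig_ext).
Defined.

(* ** Global points of a positive topology *)

(* The topology is induced along the injection forgetting that a frame
   homomorphism [p] underlies an arrow [Delta Omega -> A]. *)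
Definition ptp_space (A : PTop) : Space :=
  @induced (pt_space (base A)) (@Hom PTop (Delta Omega) A)
    (fun p => @fmap _ _ U (Delta Omega) A p).

Lemma ptp_map_continuous {A B : PTop} (f : Hom A B) :
  @continuous (ptp_space A) (ptp_space B) (fun p => comp f p).
Proof.
intros V [W [OW ->]].
exists (fun p => W (proj1_sig (fmap Pt (fmap U f)) p)); split.
- exact (proj2_sig (fmap Pt (fmap U f)) W OW).
- apply pred_ext; intros p.
  now rewrite (fmap_comp U f p).
Qed.

Definition Pt_plus : Functor PTop Top.
Proof.
refine {| fobj := ptp_space : PTop -> Top;
          fmap A B f := exist _ (fun p => comp f p) (ptp_map_continuous f) :
            @Hom Top (ptp_space A) (ptp_space B) |}.
- abstract (intros A; apply sig_ext, functional_extensionality; intros p;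
    now apply sig_ext).
- abstract (intros A B C g f; apply sig_ext, functional_extensionality;
    intros p; now apply sig_ext).
Defined.

(* ** The positive topology of closed subsets of a space *)

Definition closed {X : Space} (C : X -> Prop) : Prop :=
  forall x, (forall I, open I -> I x -> meets C I) -> C x.

Definition phi_of {X : Space} (C : X -> Prop) : opens X -> Omega :=
  fun I => meets C (proj1_sig I).

Lemma phi_of_sl_hom {X : Space} (C : X -> Prop) : is_sl_hom (phi_of C).
Proof.
intros S; apply propositional_extensionality; split.
- intros [x [Cx [V [[V' [SV' <-]] Vx]]]].
  exists (phi_of C V'); split; [now exists V' | now exists x].
- intros [P [[V [SV <-]] [x [Cx Vx]]]].
  exists x; split; [assumption|].
  exists (proj1_sig V); split; [now exists V | assumption].
Qed.

Definition closure {X : Space} (D : X -> Prop) : X -> Prop :=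
  fun x => forall I, open I -> I x -> meets D I.

Lemma closure_closed {X : Space} (D : X -> Prop) : closed (closure D).
Proof.
intros x H I OI Ix; destruct (H I OI Ix) as [y [Dy Iy]]; now apply Dy.
Qed.

Lemma phi_of_closure {X : Space} (D : X -> Prop) :
  phi_of (closure D) = phi_of D.
Proof.
apply functional_extensionality; intros [I OI].
apply propositional_extensionality; split.
- intros [x [Dx Ix]]; exact (Dx I OI Ix).
- intros [x [Dx Ix]]; exists x; split; [|exact Ix].
  intros J OJ Jx; now exists x.
Qed.

Definition is_phi_closed {X : Space} (phi : opens X -> Omega) : Prop :=
  exists C, closed C /\ phi = phi_of C.

Lemma is_phi_closed_sl_hom {X : Space} (phi : opens X -> Omega) :
  is_phi_closed phi -> is_sl_hom phi.
Proof. intros [C [_ ->]]; apply phi_of_sl_hom. Qed.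

Lemma is_phi_closed_sup {X : Space} (S : (opens X -> Omega) -> Prop) :
  (forall phi, S phi -> is_phi_closed phi) -> is_phi_closed (pointwise_sup S).
Proof.
intros HS; set (D := fun x => exists C, S (phi_of C) /\ C x).
exists (closure D); split; [apply closure_closed|].
rewrite phi_of_closure; apply functional_extensionality; intros I.
apply propositional_extensionality; split.
- intros [P [[phi [Sphi <-]] H]].
  destruct (HS phi Sphi) as [C [_ ->]]; destruct H as [x [Cx Ix]].
  exists x; split; [now exists C | assumption].
- intros [x [[C [SC Cx]] Ix]].
  exists (phi_of C I); split; [now exists (phi_of C) | now exists x].
Qed.

Definition closed_postop (X : Space) : PosTop := {|
  base := opens X;
  pos := is_phi_closed;
  pos_sl_hom := @is_phi_closed_sl_hom X;
  pos_sup := @is_phi_closed_sup X |}.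

Lemma preimage_PTop_hom {X Y : Space} (f : {f : X -> Y | continuous f}) :
  @is_PTop_hom (closed_postop X) (closed_postop Y) (preimage f).
Proof.
split; [apply preimage_frame_hom|]; intros phi [C [_ ->]].
exists (closure (image (proj1_sig f) C)); split; [apply closure_closed|].
rewrite phi_of_closure; apply functional_extensionality; intros V.
apply propositional_extensionality; split.
- intros [x [Cx Vx]]; exists (proj1_sig f x); split; [now exists x | exact Vx].
- intros [y [[x [Cx <-]] Vx]]; now exists x.
Qed.

Definition Lambda : Functor Top PTop.
Proof.
refine {| fobj := closed_postop : Top -> PTop;
          fmap X Y f := exist _ (preimage f) (preimage_PTop_hom f) :
            @Hom PTop (closed_postop X) (closed_postop Y) |}.
- abstract (intros X; apply sig_ext, functional_extensionality; intros V;
    now apply sig_ext).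
- abstract (intros X Y Z g f; apply sig_ext, functional_extensionality;
    intros V; now apply sig_ext).
Defined.

(* Main.v *)
From Stdlib Require Import FunctionalExtensionality PropExtensionality
  ProofIrrelevance.
Require Import Defs.

(** A join-preserving map [phi : Omega -> Omega] is [P |-> P /\ phi True],
    because [P] is the join of the subsingleton [{True | P}].  So if [Phi] is
    closed under joins and contains the frame homomorphism [p], it contains
    every [phi o p]: this is the subsingleton join of those copies of [p] for
    which [phi True] holds.  Hence a global point of [(L, Phi)] is a point of
    [L] that lies in [Phi] ([point_PTop_hom], [global_point_pos]).

    For [L] with all of [SL(L, Omega)] the extra condition is vacuous, so
    [Pt] and [Pt_plus o Delta] agree.  For a space [X], the point [U |-> x in U]
    is [phi_C] for [C] the closure of [x], which gives the unit of
    [Lambda -| Pt_plus]; the counit [y |-> {p | p y}] is an arrow of [PTop]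
    because [phi_C] composed with it is the join of the points in [C].  Both
    have the same underlying maps as the unit and counit of [OmegaF -| Pt].

    The equalities of functors are equalities on the nose, so the comparison of
    the two adjunctions involves transport along them.  Two observations keep
    this manageable.  An adjunction is determined by its unit
    ([adjunction_ext]), so only units have to be compared; and transporting an
    adjunction composes its unit with the arrows [eq_hom] induced by equalities
    of objects ([castAdj_unit]).  By proof irrelevance such an arrow depends on
    its endpoints only: it is the identity on [opens X], and from [Pt L] to
    [Pt_plus (Delta L)] it leaves the underlying function of a point unchanged,
    as it is a cast between subsets of the same function type with
    equivalent defining predicates ([cast_sig]). *)

Set Implicit Arguments.
Unset Strict Implicit.
Unset Printing Implicit Defensive.

(** * Equality of functors and of adjunctions *)

Definition cast {A B : Type} (e : A = B) : A -> B :=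
  match e with eq_refl => fun a => a end.

(** The equality [e] need not come from the equality of the predicates: by
    proof irrelevance there is only one. *)
Lemma cast_sig {A : Type} (P Q : A -> Prop) (PQ : forall a, P a <-> Q a)
    (e : sig P = sig Q) (u : sig P) :
  proj1_sig (cast e u) = proj1_sig u.
Proof.
pose proof (pred_ext PQ) as E; subst Q.
now rewrite (proof_irrelevance _ e eq_refl).
Qed.

Lemma sig_eq {A : Type} (P Q : A -> Prop) :
  (forall a, P a <-> Q a) -> sig P = sig Q.
Proof. intros PQ; now rewrite (pred_ext PQ). Qed.

Definition eq_hom {C : Category} {X Y : C} (e : X = Y) : Hom X Y :=
  match e with eq_refl => ident X end.

Lemma functor_ext {C D : Category} (F G : Functor C D)
    (e : forall X, F X = G X) :
  (forall X Y (f : Hom X Y),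
    comp (eq_hom (e Y)) (fmap F f) = comp (fmap G f) (eq_hom (e X))) ->
  F = G.
Proof.
destruct F as [F Fm Fi Fc], G as [G Gm Gi Gc]; simpl in *.
assert (E : F = G) by now apply functional_extensionality.
subst G; intros H.
assert (E : Fm = Gm).
{ apply functional_extensionality_dep; intros X.
  apply functional_extensionality_dep; intros Y.
  apply functional_extensionality; intros f.
  specialize (H X Y f).
  rewrite (proof_irrelevance _ (e X) eq_refl),
    (proof_irrelevance _ (e Y) eq_refl) in H; simpl in H.
  now rewrite comp_ident_l, comp_ident_r in H. }
subst Gm; f_equal; apply proof_irrelevance.
Qed.

Definition eq_component {C D : Category} {F G : Functor C D} (e : F = G)
    (X : C) : Hom (F X) (G X) :=
  eq_hom (f_equal (fun H : Functor C D => H X) e).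

(** This replaces dependent elimination of the equalities by composition with
    arrows that can be computed pointwise. *)
Lemma castAdj_unit {C D : Category} {F F' : Functor C D} {G G' : Functor D C}
    (eF : F = F') (eG : G = G') (A : Adjunction F G) (X : C) :
  adj_unit (castAdj eF eG A) X =
  comp (eq_component eG (F' X))
    (comp (fmap G (eq_component eF X)) (adj_unit A X)).
Proof.
destruct eF, eG; unfold eq_component; simpl.
now rewrite fmap_ident, !comp_ident_l.
Qed.

(** The counits agree because
    [eps_Y = eps_Y o F (G eps'_Y o eta_GY) = eps'_Y o eps_FGY o F eta_GY = eps'_Y],
    by a triangle for [B], naturality of [eps] and a triangle for [A]. *)
Lemma adjunction_ext {C D : Category} {F : Functor C D} {G : Functor D C}
    (A B : Adjunction F G) :
  (forall X, adj_unit A X = adj_unit B X) -> A = B.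
Proof.
intros H.
assert (Hc : forall Y, adj_counit A Y = adj_counit B Y).
{ intros Y.
  rewrite <- (comp_ident_r (adj_counit A Y)), <- fmap_ident.
  rewrite <- (triangle_r B Y), <- H, fmap_comp, comp_assoc.
  rewrite (adj_counit_natural A), <- comp_assoc, (triangle_l A).
  apply comp_ident_r. }
destruct A as [u c un cn tl tr], B as [u' c' un' cn' tl' tr']; simpl in *.
assert (E : u = u') by now apply functional_extensionality_dep.
assert (E' : c = c') by now apply functional_extensionality_dep.
subst u' c'; f_equal; apply proof_irrelevance.
Qed.

(** * Equality of spaces *)

Lemma space_ext (X Y : Space) (e : pts X = pts Y) :
  (forall V : Y -> Prop, open (fun x => V (cast e x)) <-> open V) -> X = Y.
Proof.
destruct X as [X OX ? ? ?], Y as [Y OY ? ? ?]; simpl in *.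
destruct e; intros H.
assert (E : OX = OY) by now apply pred_ext.
subst OY; f_equal; apply proof_irrelevance.
Qed.

Lemma eq_hom_Top (X Y : Space) (e : X = Y) (x : X) :
  proj1_sig (@eq_hom Top X Y e) x = cast (f_equal pts e) x.
Proof. now destruct e. Qed.

(** * Global points *)

(** Every truth value [P] is the join of the subsingleton [{True | P}], so
    [phi] is determined by its value at [True]. *)
Lemma Omega_sl_hom (phi : Omega -> Omega) (P : Prop) :
  is_sl_hom phi -> phi P = (P /\ phi True).
Proof.
intros H.
assert (E : P = sup (fun Q : Omega => P /\ Q = True)).
{ apply propositional_extensionality; split.
  - intros p; now exists True.
  - now intros [Q [[p _] _]]. }
rewrite E at 1; rewrite H; apply propositional_extensionality; split.
- now intros [R [[Q [[p ->] <-]] r]].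
- intros [p t]; exists (phi True); split; [now exists True | exact t].
Qed.

(** Since [phi o p] is the join of the subsingleton [{p | phi True}], membership
    of [p] in [pos A] already gives the whole positivity condition. *)
Lemma point_PTop_hom (A : PosTop) (p : base A -> Omega) :
  is_frame_hom p -> pos A p -> @is_PTop_hom (full_postop Omega) A p.
Proof.
intros Hp Ap; split; [exact Hp|]; intros phi Hphi.
assert (E : (fun y => phi (p y)) =
    pointwise_sup (fun psi : base A -> Omega => psi = p /\ phi True)).
{ apply functional_extensionality; intros y.
  rewrite (Omega_sl_hom (p y) Hphi).
  apply propositional_extensionality; split.
  - intros [py t]; exists (p y); split; [now exists p | exact py].
  - now intros [P [[psi [[-> t] <-]] py]]. }
rewrite E; apply pos_sup; now intros psi [-> _].
Qed.

(** The identity of [Omega] preserves joins, so [p] itself is one of the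
    composites that [p] must send into [pos A]. *)
Lemma global_point_pos (A : PosTop) (p : base A -> Omega) :
  @is_PTop_hom (full_postop Omega) A p -> pos A p.
Proof.
intros [_ H]; exact (H (fun P => P) (proj1 (is_frame_hom_id Omega))).
Qed.

(** * The functor equalities *)

Lemma full_point_iff (L : Frame) (p : L -> Omega) :
  is_frame_hom p <-> @is_PTop_hom (full_postop Omega) (full_postop L) p.
Proof.
split.
- intros Hp; apply point_PTop_hom; [exact Hp | exact (proj1 Hp)].
- now intros [Hp _].
Qed.

Lemma pt_space_full (L : Frame) : pt_space L = ptp_space (full_postop L).
Proof.
set (e := sig_eq (@full_point_iff L) :
  pts (pt_space L) = pts (ptp_space (full_postop L))).
assert (He : forall p, proj1_sig (cast e p) = proj1_sig p)
  by (intros p; apply (cast_sig (@full_point_iff L))).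
assert (Hs : forall q, exists p, cast e p = q).
{ intros [q Hq]; exists (exist _ q (proj1 Hq)); apply sig_ext, He. }
apply (space_ext (e := e)); intros V; split.
- intros [y Ey]; exists (fun p => proj1_sig p y); split; [now exists y|].
  apply pred_ext; intros q; destruct (Hs q) as [p <-]; simpl.
  change (V (cast e p)) with ((fun p => V (cast e p)) p); rewrite Ey.
  now rewrite He.
- intros [W [[y ->] ->]]; exists y; apply pred_ext; intros p; simpl.
  now rewrite He.
Qed.

Lemma eq_hom_pt_space (L : Frame) (e : pt_space L = ptp_space (full_postop L))
    (p : pt_space L) :
  proj1_sig (proj1_sig (@eq_hom Top _ _ e) p) = proj1_sig p.
Proof. rewrite eq_hom_Top; apply (cast_sig (@full_point_iff L)). Qed.

Lemma Pt_eq : Pt = compF Pt_plus Delta.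
Proof.
apply (functor_ext (F := Pt) (G := compF Pt_plus Delta) (e := pt_space_full)).
intros L M f; apply sig_ext, functional_extensionality; intros p.
apply sig_ext; transitivity (fun y => proj1_sig p (proj1_sig f y)).
- exact (eq_hom_pt_space (pt_space_full M) _).
- exact (f_equal (fun q y => q (proj1_sig f y))
    (eq_sym (eq_hom_pt_space (pt_space_full L) p))).
Qed.

Lemma OmegaF_eq : OmegaF = compF U Lambda.
Proof.
apply (functor_ext (F := OmegaF) (G := compF U Lambda) (e := fun X => eq_refl)).
intros X Y f; now apply sig_ext.
Qed.

(** * The adjunction between spaces and positive topologies *)

Lemma mem_pos {X : Space} (x : X) :
  pos (closed_postop X) (fun V => proj1_sig V x).
Proof.
exists (closure (fun y => y = x)); split; [apply closure_closed|].
rewrite phi_of_closure; apply functional_extensionality; intros V.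
apply propositional_extensionality; split.
- intros Vx; now exists x.
- now intros [y [-> Vx]].
Qed.

Definition ptp_unit (X : Space) : @Hom Top X (ptp_space (closed_postop X)).
Proof.
refine (exist _ (fun x => exist _ (fun V : opens X => proj1_sig V x)
  (@point_PTop_hom (closed_postop X) _ (mem_frame_hom x) (mem_pos x))) _).
abstract (intros V [W [[y ->] ->]]; exact (proj2_sig y)).
Defined.

Lemma ptp_incl_continuous (A : PosTop) :
  @continuous (ptp_space A) (pt_space (base A))
    (fun p => @fmap _ _ U (Delta Omega) A p).
Proof. intros V OV; now exists V. Qed.

(** The counit of [OmegaF -| Pt], restricted to the subspace of global points. *)
Definition ptp_counit_fun (A : PosTop) (y : base A) : opens (ptp_space A) :=
  preimage (Y := pt_space (base A)) (exist _ _ (@ptp_incl_continuous A))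
    (proj1_sig (pt_counit (base A)) y).

(** Composing with the counit turns [phi_C] into the pointwise join of the
    global points in [C], each of which lies in [pos A]. *)
Lemma ptp_counit_PTop_hom (A : PosTop) :
  @is_PTop_hom (closed_postop (ptp_space A)) A (@ptp_counit_fun A).
Proof.
split.
{ exact (is_frame_hom_comp (preimage_frame_hom _)
    (proj2_sig (pt_counit (base A)))). }
intros phi [C [_ ->]].
assert (E : (fun y => phi_of C (ptp_counit_fun y)) =
    pointwise_sup (image (fun p : ptp_space A => proj1_sig p) C)).
{ apply functional_extensionality; intros y.
  apply propositional_extensionality; split.
  - intros [p [Cp py]]; exists (proj1_sig p y); split; [|exact py].
    exists (proj1_sig p); split; [now exists p | reflexivity].
  - intros [P [[psi [[p [Cp <-]] <-]] py]]; now exists p. }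
rewrite E; apply pos_sup; intros psi [p [_ <-]].
exact (global_point_pos (proj2_sig p)).
Qed.

Definition Lambda_Pt_plus : Adjunction Lambda Pt_plus.
Proof.
refine {| adj_unit := ptp_unit : forall X : Top, Hom X (Pt_plus (Lambda X));
          adj_counit := (fun A => exist _ _ (@ptp_counit_PTop_hom A)) :
            forall A : PTop, Hom (Lambda (Pt_plus A)) A |}.
- abstract (intros X X' f; apply sig_ext, functional_extensionality; intros x;
    now apply sig_ext).
- abstract (intros A B g; apply sig_ext, functional_extensionality; intros y;
    now apply sig_ext).
- abstract (intros X; apply sig_ext, functional_extensionality; intros V;
    now apply sig_ext).
- abstract (intros A; apply sig_ext, functional_extensionality; intros p;
    now apply sig_ext).
Defined.

(** * The factorization *)

Lemma eq_component_OmegaF (e : OmegaF = compF U Lambda) (X : Space) :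
  eq_component e X = @ident Loc (opens X).
Proof.
unfold eq_component.
generalize (f_equal (fun H : Functor Top Loc => H X) e); simpl; intros e'.
now rewrite (proof_irrelevance _ e' eq_refl).
Qed.

Theorem mainTheorem2 :
  exists (ePt : Pt = compF Pt_plus Delta)
         (eOmega : OmegaF = compF U Lambda)
         (Lambda_Pt_plus : Adjunction Lambda Pt_plus),
    castAdj eOmega ePt OmegaF_Pt = compAdj Lambda_Pt_plus U_Delta.
Proof.
exists Pt_eq, OmegaF_eq, Lambda_Pt_plus.
apply adjunction_ext; intros X; rewrite castAdj_unit.
rewrite (eq_component_OmegaF OmegaF_eq X).
(* Both units send [x] to a point whose underlying map is [V |-> x in V]. *)
apply sig_ext, functional_extensionality; intros x; apply sig_ext.
exact (eq_hom_pt_space _ _).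
Qed.
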